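(* Let $n,b,c,d,e$ be nonnegative integers. Then \[\sum_{k=0}^n \binom{n}{k}^2\frac{\binom{n+bn}{k}\binom{n+cn}{k}\binom{n+dn}{k}\binom{n+en}{k}}{\binom{k+bn}{k}\binom{k+cn}{k}\binom{k+dn}{k}\binom{k+en}{k}}\Big\{1+(n-2k)\big(2H_k+H_{bn+k}+H_{cn+k}+H_{dn+k}+H_{en+k}\big)\Big\}\] \[= (-1)^n\frac{\binom{2n+bn+dn}{n}}{\binom{n+bn}{n}\binom{n+dn}{n}}\sum_{\ell=0}^n\binom{n}{\ell}\frac{\binom{n+bn}{\ell}\binom{n+dn}{\ell}\binom{n+cn+en+\ell}{\ell}}{\binom{\ell+cn}{\ell}\binom{\ell+en}{\ell}\binom{2n+bn+dn}{\ell}}.\]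
   Context: $H_0=0$ and $H_m=\sum_{j=1}^m \frac{1}{j}$ for positive integers $m$ (classical harmonic numbers). *)

(* Defs.v *)
From mathcomp Require Import all_boot all_order all_algebra.

Set Implicit Arguments.
Unset Strict Implicit.
Unset Printing Implicit Defensive.

Import GRing.Theory.
Local Open Scope ring_scope.

Definition harmonic_number (m : nat) : rat := \sum_(1 <= j < m.+1) j%:R^-1.

(* Binomial coefficient valued in rat, so that quotients of binomials are
   exact quotients and not truncated divisions in nat. *)
Definition binq (m k : nat) : rat := 'C(m, k)%:R.

(* Main.v *)
Require Import Defs.
From mathcomp Require Import all_boot all_order all_algebra.
From mathcomp Require Import ring.

Import Num.Theory GRing.Theory.
Local Open Scope ring_scope.

(* Put b' = -(n + bn), and likewise c', d', e', in Whipple's transformation of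
   the very-well-poised 7F6 with parameters a, b', c', d', e', -n into a
   balanced 4F3.  At a = -n + X both sides are rational functions of X that
   are regular at X = 0, and the factor (a)_{n+1} makes the right-hand side
   vanish there.  The coefficients of X give the identity, up to the symmetry
   k -> n - k of the weights, which turns the H_{n-k} produced by
   differentiating (a)_k into -H_k and kills the terms independent of k.

   Whipple's transformation follows by expanding the (c')_k (e')_k part with
   the Pfaff-Saalschutz sum, exchanging the sums, and evaluating the inner one
   with the very-well-poised 5F4 sum. *)

(** * Rising factorials (Pochhammer symbols) *)

Definition rising (R : pzRingType) (x : R) (k : nat) : R := \prod_(i < k) (x + i%:R).
Arguments rising {R}.

Lemma risingS (R : pzRingType) (x : R) k : rising x k.+1 = rising x k * (x + k%:R).
Proof. by rewrite /rising big_ord_recr. Qed.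

Lemma rising0 (R : pzRingType) (x : R) : rising x 0 = 1.
Proof. by rewrite /rising big_ord0. Qed.

Lemma risingD (R : pzRingType) (x : R) m k :
  rising x (m + k) = rising x m * rising (x + m%:R) k.
Proof.
elim: k => [|k IH]; first by rewrite addn0 rising0 mulr1.
by rewrite addnS !risingS IH natrD !mulrA !addrA.
Qed.

Lemma rising_shift (R : comPzRingType) (x : R) k :
  x * rising (x + 1) k = rising x k * (x + k%:R).
Proof.
by rewrite -risingS -add1n risingD /rising big_ord1 addr0.
Qed.

(** The factor with index [n] is zero. This is what makes the hypergeometric sums terminate. *)
Lemma rising_oppn_eq0 (R : pzRingType) n k : (n < k)%N -> rising (- n%:R : R) k = 0.
Proof.
move=> lt_nk; rewrite -(subnKC lt_nk) risingD risingS addNr mulr0 mul0r //.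
Qed.

Lemma rising_neq0 (F : idomainType) (x : F) k :
  (forall i : nat, x + i%:R != 0) -> rising x k != 0.
Proof. by move=> nz; apply/prodf_neq0 => i _. Qed.

Lemma fact_neq0 (F : idomainType) k :
  (forall m, m.+1%:R != 0 :> F) -> (k`!)%:R != 0 :> F.
Proof.
move=> char0; elim: k => [|k IH]; first exact: (char0 0).
by rewrite factS natrM mulf_neq0.
Qed.

(** * The Pfaff-Saalschutz and very-well-poised 5F4 sums *)

(** Both sides satisfy (u+k)(v+k) S(k+1) = (1+a-u+k)(1+a-v+k) S(k), the sum by telescoping. The
    numerators [c] and [e] are tied to [u] and [v] by equations so that well-poised pairs can be
    substituted directly. *)
Lemma saalschutz (F : fieldType) (a c e u v : F) k :
  (forall m, m.+1%:R != 0 :> F) ->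
  (forall i : nat, a + i%:R != 0) ->
  (forall i : nat, u + i%:R != 0) -> (forall i : nat, v + i%:R != 0) ->
  c = 1 + a - u -> e = 1 + a - v ->
  \sum_(l < k.+1) rising (- k%:R) l * rising (a + k%:R) l * rising (u + v - 1 - a) l
                  / ((l`!)%:R * rising u l * rising v l)
  = rising c k * rising e k / (rising u k * rising v k).
Proof.
move=> char0 nza nzu nzv -> ->.
elim: k => [|k IH].
  by rewrite big_ord1 /rising !big_ord0 fact0 !mulr1 divr1.
pose t (k l : nat) := rising (- k%:R) l * rising (a + k%:R) l * rising (u + v - 1 - a) l
                  / ((l`!)%:R * rising u l * rising v l).
(* WZ certificate for the recurrence in [k]. *)
pose g (l : nat) := - (2 * k%:R + 1 + a) / (k.+1%:R * (a + k%:R))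
  * (l%:R * (u + l%:R - 1) * (v + l%:R - 1))
  * (rising (- k.+1%:R) l * rising (a + k%:R) l * rising (u + v - 1 - a) l
     / ((l`!)%:R * rising u l * rising v l)).
have nzk := char0 k; have nzak := nza k.
have tel m : \sum_(l < m) ((u + k%:R) * (v + k%:R) * t k.+1 l
      - (1 + a - u + k%:R) * (1 + a - v + k%:R) * t k l) = g m.
  elim: m => [|m IHm]; first by rewrite big_ord0 /g !(mul0r, mulr0).
  rewrite big_ord_recr /= IHm /g /t.
  (* The shifts [e1] and [e2] write the terms at [k] and [k.+1] through the same rising factorials;
     once these are generalized, only an identity of rational functions is left. *)
  have e1 : rising (- k%:R) m = rising (- k.+1%:R) m * (k.+1%:R - m%:R) / k.+1%:R :> F.
    have := rising_shift F (- k.+1%:R) m.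
    have -> : - k.+1%:R + 1 = - k%:R :> F by rewrite -natr1; ring.
    have nzk' : - k.+1%:R != 0 :> F by rewrite oppr_eq0.
    by move=> h; apply: (mulfI nzk'); rewrite h; field; rewrite nat1r.
  have e2 : rising (a + k.+1%:R) m = rising (a + k%:R) m * (a + k%:R + m%:R) / (a + k%:R).
    have := rising_shift F (a + k%:R) m.
    have -> : a + k%:R + 1 = a + k.+1%:R by rewrite -natr1; ring.
    by move=> h; apply: (mulfI nzak); rewrite h; field; exact: nzak.
  rewrite e1 e2 !risingS factS natrM.
  have := fact_neq0 F m char0; have := rising_neq0 F u m nzu; have := rising_neq0 F v m nzv.
  have := nzu m; have := nzv m; have := char0 m.
  move: (rising _ m) (rising _ m) (rising _ m) (rising u m) (rising v m) (m`!)%:R.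
  move=> A B C U V f.
  move: nzk nzak; rewrite -!(natr1 k) -!(natr1 m).
  move: k%:R m%:R => K M nzk nzak h1 h2 h3 h4 h5 h6.
  by field; do !(apply/andP; split).
(* The range [k.+2] covers both supports: the sum at [k.+1] is complete, the sum at [k] gains one
   zero term, and the certificate vanishes at the upper end. *)
have := tel k.+2.
have -> : g k.+2 = 0 by rewrite /g rising_oppn_eq0 // !mul0r mulr0.
rewrite big_split /= sumrN -!mulr_sumr [X in _ - _ * X]big_ord_recr /=.
have -> : t k k.+1 = 0 by rewrite /t rising_oppn_eq0 // !mul0r.
rewrite addr0 [X in _ - _ * X]IH => /eqP; rewrite subr_eq0 => /eqP eq.
apply: (mulfI (mulf_neq0 (nzu k) (nzv k))); rewrite [LHS]eq !risingS.
field.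
by rewrite !nzu !nzv !rising_neq0.
Qed.

(** The classical factor (a/2+1)_k / (a/2)_k equals (a+2k)/a. Multiplying through by [a] leaves a+2k
    in the sum and turns (1+a)_n into (a)_{n+1}. The proof is again telescoping, with S(n+1)/S(n) =
    (1+a+n)(u+v-1-a+n) / ((u+n)(v+n)). *)
Lemma well_poised_5F4 (F : fieldType) (a b d u v : F) n :
  (forall m, m.+1%:R != 0 :> F) ->
  (forall i : nat, a + i%:R != 0) ->
  (forall i : nat, u + i%:R != 0) -> (forall i : nat, v + i%:R != 0) ->
  b = 1 + a - u -> d = 1 + a - v ->
  \sum_(k < n.+1) (a + 2 * k%:R) * (rising a k * rising b k * rising d k * rising (- n%:R) k
                  / ((k`!)%:R * rising u k * rising v k * rising (1 + a + n%:R) k))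
  = rising a n.+1 * rising (u + v - 1 - a) n / (rising u n * rising v n).
Proof.
move=> char0 nza nzu nzv -> ->.
elim: n => [|n IH].
  by rewrite big_ord1 /rising !big_ord0 big_ord1 fact0 /=; field; rewrite oner_neq0.
pose t (n k : nat) := (a + 2 * k%:R) * (rising a k * rising (1 + a - u) k * rising (1 + a - v) k
   * rising (- n%:R) k / ((k`!)%:R * rising u k * rising v k * rising (1 + a + n%:R) k)).
(* WZ certificate for the recurrence in [n]. *)
pose g (k : nat) := - (1 + a + n%:R) / n.+1%:R
  * (k%:R * (u + k%:R - 1) * (v + k%:R - 1))
  * (rising a k * rising (1 + a - u) k * rising (1 + a - v) k * rising (- n.+1%:R) k
     / ((k`!)%:R * rising u k * rising v k * rising (1 + a + n%:R) k)).
have nzn := char0 n.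
have nzan i : 1 + a + n%:R + i%:R != 0.
  by rewrite (_ : _ + _ = a + (n + i).+1%:R) ?nza // -natr1 natrD; ring.
have nz1 : 1 + a + n%:R != 0 by have := nzan 0; rewrite addr0.
have tel m : \sum_(k < m) ((u + n%:R) * (v + n%:R) * t n.+1 k
      - (1 + a + n%:R) * (u + v - 1 - a + n%:R) * t n k) = g m.
  elim: m => [|m IHm]; first by rewrite big_ord0 /g !(mul0r, mulr0).
  rewrite big_ord_recr /= IHm /g /t.
  have e1 : rising (- n%:R) m = rising (- n.+1%:R) m * (n.+1%:R - m%:R) / n.+1%:R :> F.
    have := rising_shift F (- n.+1%:R) m.
    have -> : - n.+1%:R + 1 = - n%:R :> F by rewrite -natr1; ring.
    have nzn' : - n.+1%:R != 0 :> F by rewrite oppr_eq0.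
    by move=> h; apply: (mulfI nzn'); rewrite h; field; rewrite nat1r.
  have e2 : rising (1 + a + n.+1%:R) m
          = rising (1 + a + n%:R) m * (1 + a + n%:R + m%:R) / (1 + a + n%:R).
    have := rising_shift F (1 + a + n%:R) m.
    have -> : 1 + a + n%:R + 1 = 1 + a + n.+1%:R by rewrite -natr1; ring.
    by move=> h; apply: (mulfI nz1); rewrite h; field; exact: nz1.
  rewrite e1 e2 !risingS factS natrM.
  have := fact_neq0 F m char0; have := rising_neq0 F u m nzu; have := rising_neq0 F v m nzv.
  have := rising_neq0 F _ m nzan.
  have := nzu m; have := nzv m; have := char0 m; have := nzan m.
  move: (rising a m) (rising (1 + a - u) m) (rising (1 + a - v) m) (rising (- _) m).
  move: (rising _ m) (rising u m) (rising v m) (m`!)%:R.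
  move=> N U V f A B C D.
  move: nzn nz1; rewrite -!(natr1 n) -!(natr1 m).
  move: n%:R m%:R => K M nzk nzak h1 h2 h3 h4 h5 h6 h7 h8.
  by field; do !(apply/andP; split).
have := tel n.+2.
have -> : g n.+2 = 0 by rewrite /g rising_oppn_eq0 // !mulr0 mul0r mulr0.
rewrite big_split /= sumrN -!mulr_sumr [X in _ - _ * X]big_ord_recr /=.
have -> : t n n.+1 = 0 by rewrite /t rising_oppn_eq0 // mulr0 mul0r mulr0.
rewrite addr0 [X in _ - _ * X]IH => /eqP; rewrite subr_eq0 => /eqP eq.
apply: (mulfI (mulf_neq0 (nzu n) (nzv n))); rewrite [LHS]eq !risingS -(natr1 n).
field.
by rewrite !nzu !nzv !rising_neq0.
Qed.

(** * Whipple's transformation *)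

Lemma rising_reflect (R : comPzRingType) (x : R) l :
  rising (1 - x - l%:R) l = (-1) ^+ l * rising x l.
Proof.
rewrite /rising (reindex_inj rev_ord_inj) /= -[X in (-1) ^+ X]card_ord -prodr_const -big_split /=.
by apply: eq_bigr => i _; rewrite natrB // -natr1; ring.
Qed.

Lemma rising1 (R : pzRingType) k : rising (1 : R) k = (k`!)%:R.
Proof.
elim: k => [|k IH]; first by rewrite rising0.
by rewrite risingS IH nat1r -natrM factS mulnC.
Qed.

(** This is the inner sum after the exchange in Whipple's transformation. The factor (-k)_l kills
    the terms with k < l; putting k = l+j gives the 5F4 sum with a+2l, b+l, d+l, n-l, for which
    u+v-1-a is unchanged. *)
Lemma well_poised_5F4_shift (F : fieldType) (a b d u v : F) n l :
  (forall m, m.+1%:R != 0 :> F) ->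
  (forall i : nat, a + i%:R != 0) ->
  (forall i : nat, u + i%:R != 0) -> (forall i : nat, v + i%:R != 0) ->
  (forall i : nat, b + d - n%:R - a + i%:R != 0) ->
  u = 1 + a - b -> v = 1 + a - d -> (l <= n)%N ->
  \sum_(k < n.+1) (a + 2 * k%:R) * (rising a k * rising b k * rising d k * rising (- n%:R) k
                  / ((k`!)%:R * rising u k * rising v k * rising (1 + a + n%:R) k))
         * (rising (- k%:R) l * rising (a + k%:R) l)
  = rising a n.+1 * rising (1 + a - b - d) n / (rising u n * rising v n)
    * (rising (- n%:R) l * rising b l * rising d l / rising (b + d - n%:R - a) l).
Proof.
move=> char0 nza nzu nzv nzw eu ev le_ln.
have nzan i : 1 + a + n%:R + i%:R != 0.
  by rewrite (_ : _ + _ = a + (n + i).+1%:R) ?nza // -natr1 natrD; ring.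
have [m en] : exists m, n = (l + m)%N by exists (n - l)%N; rewrite subnKC.
subst n => {le_ln}; rewrite -addnS big_split_ord /= big1 ?add0r; last first.
  by move=> i _; rewrite (rising_oppn_eq0 F i l) ?ltn_ord // mul0r mulr0.
have nza' i : a + (l + l)%:R + i%:R != 0 by rewrite -addrA -natrD nza.
have nzu' i : u + l%:R + i%:R != 0 by rewrite -addrA -natrD nzu.
have nzv' i : v + l%:R + i%:R != 0 by rewrite -addrA -natrD nzv.
have eb : b + l%:R = 1 + (a + (l + l)%:R) - (u + l%:R) by rewrite eu natrD; ring.
have ed : d + l%:R = 1 + (a + (l + l)%:R) - (v + l%:R) by rewrite ev natrD; ring.
have := well_poised_5F4 _ _ _ _ _ _ m char0 nza' nzu' nzv' eb ed.
rewrite (_ : u + l%:R + (v + l%:R) - 1 - (a + (l + l)%:R) = 1 + a - b - d); last first.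
  by rewrite eu ev natrD; ring.
(* [C] gathers the factors free of j, after (a)_{l+j} (a+l+j)_l is read as (a)_{2l} (a+2l)_j and
   (-(l+j))_l as (-1)^l (l+j)!/j!. *)
pose C := (-1) ^+ l * rising a (l + l) * rising b l * rising d l * rising (- (l + m)%:R) l
   / (rising u l * rising v l * rising (1 + a + (l + m)%:R) l) : F.
move=> /(congr1 ( *%R C)); rewrite mulr_sumr => eq.
transitivity (C * (rising (a + (l + l)%:R) m.+1 * rising (1 + a - b - d) m /
        (rising (u + l%:R) m * rising (v + l%:R) m))).
  rewrite -eq; apply: eq_bigr => j _; rewrite /C.
  have ea : rising a (l + j) = rising a (l + l) * rising (a + (l + l)%:R) j
                             / rising (a + (l + j)%:R) l.
    apply: (canRL (mulfK _)); last by rewrite -!risingD addnAC.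
    by apply: rising_neq0 => i; rewrite -addrA -natrD nza.
  have ef : rising (- (l + j)%:R) l = (-1) ^+ l * ((l + j)`!)%:R / (j`!)%:R :> F.
    apply: (canRL (mulfK (fact_neq0 F j char0))).
    rewrite (_ : - _ = 1 - (1 + j%:R) - l%:R :> F); last by rewrite natrD; ring.
    by rewrite rising_reflect -!rising1 -mulrA [_ * rising 1 j]mulrC -risingD [(j + l)%N]addnC.
  rewrite ea ef !(risingD _ _ l j).
  rewrite (_ : - (l + m)%:R + l%:R = - m%:R :> F); last by rewrite natrD; ring.
  rewrite (_ : 1 + a + (l + m)%:R + l%:R = 1 + (a + (l + l)%:R) + m%:R); last first.
    by rewrite !natrD; ring.
  rewrite (_ : a + 2 * (l + j)%:R = a + (l + l)%:R + 2 * j%:R); last by rewrite !natrD; ring.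
  have h1 : rising (a + (l + j)%:R) l != 0.
    by apply: rising_neq0 => i; rewrite -addrA -natrD nza.
  have h2 : rising (1 + (a + (l + l)%:R) + m%:R) j != 0.
    apply: rising_neq0 => i; rewrite (_ : 1 + _ + m%:R + i%:R = a + (l + l + m + i).+1%:R) ?nza //.
    by rewrite -natr1 !natrD; ring.
  by field; rewrite h1 h2 !rising_neq0 // !fact_neq0.
have -> : rising (a + (l + l)%:R) m.+1
        = rising a (l + m).+1 * rising (1 + a + (l + m)%:R) l / rising a (l + l).
  apply: (canRL (mulfK (rising_neq0 F a _ nza))).
  rewrite mulrC -risingD (_ : 1 + _ + _ = a + (l + m).+1%:R); last by rewrite -natr1; ring.
  by rewrite -risingD addnS addSn addnAC.
(* Reflecting the last l factors produces the lower parameter b+d-n-a of the 4F3. *)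
have -> : rising (1 + a - b - d) (l + m) = rising (1 + a - b - d) m
            * ((-1) ^+ l * rising (b + d - (l + m)%:R - a) l).
  by rewrite addnC risingD -rising_reflect; congr (_ * rising _ _); rewrite natrD; ring.
rewrite !(risingD _ _ l m) addnS /C; field.
by rewrite !rising_neq0.
Qed.

(** Here [c] and [e] pass through the Saalschutz sum while [b] and [d] pass through the 5F4 sum,
    whence the asymmetry of the right-hand side. The field is general because the lemma is applied
    over rational functions. *)
Lemma whipple_7F6_4F3 (F : fieldType) (a b c d e : F) n :
  (forall m, m.+1%:R != 0 :> F) ->
  (forall i : nat, a + i%:R != 0) ->
  (forall i : nat, 1 + a - b + i%:R != 0) -> (forall i : nat, 1 + a - c + i%:R != 0) ->
  (forall i : nat, 1 + a - d + i%:R != 0) -> (forall i : nat, 1 + a - e + i%:R != 0) ->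
  (forall i : nat, b + d - n%:R - a + i%:R != 0) ->
  \sum_(k < n.+1) (a + 2 * k%:R) *
     (rising a k * rising b k * rising c k * rising d k * rising e k * rising (- n%:R) k
      / ((k`!)%:R * rising (1 + a - b) k * rising (1 + a - c) k * rising (1 + a - d) k
         * rising (1 + a - e) k * rising (1 + a + n%:R) k))
  = rising a n.+1 * rising (1 + a - b - d) n / (rising (1 + a - b) n * rising (1 + a - d) n)
    * \sum_(l < n.+1) rising (- n%:R) l * rising b l * rising d l * rising (1 + a - c - e) l
        / ((l`!)%:R * rising (1 + a - c) l * rising (1 + a - e) l
           * rising (b + d - n%:R - a) l).
Proof.
move=> char0 nza nzu nzp nzv nzq nzw.
have nzan i : 1 + a + n%:R + i%:R != 0.
  by rewrite (_ : _ + _ = a + (n + i).+1%:R) ?nza // -natr1 natrD; ring.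
pose T k := (a + 2 * k%:R) * (rising a k * rising b k * rising d k * rising (- n%:R) k
  / ((k`!)%:R * rising (1 + a - b) k * rising (1 + a - d) k * rising (1 + a + n%:R) k)).
pose W l := rising (1 + a - c - e) l / ((l`!)%:R * rising (1 + a - c) l * rising (1 + a - e) l).
transitivity (\sum_(k < n.+1) \sum_(l < n.+1)
   W l * (T k * (rising (- k%:R) l * rising (a + k%:R) l))).
  apply: eq_bigr => -[k /= le_kn] _.
  have := @saalschutz F a c e (1 + a - c) (1 + a - e) k char0 nza nzp nzq ltac:(ring) ltac:(ring).
  pose S l := rising (- k%:R) l * rising (a + k%:R) l * rising (1 + a - c + (1 + a - e) - 1 - a) l
                  / ((l`!)%:R * rising (1 + a - c) l * rising (1 + a - e) l).
  (* The Saalschutz sum is extended from l <= k to l <= n, at the cost of zero terms only, so that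
     the two sums can be exchanged. *)
  rewrite (big_ord_widen n.+1 S) // /S => eq.
  transitivity (T k * (rising c k * rising e k / (rising (1 + a - c) k * rising (1 + a - e) k))).
    rewrite /T; field.
    by rewrite !rising_neq0 // fact_neq0.
  rewrite -eq mulr_sumr big_mkcond; apply: eq_bigr => l _; rewrite /= ltnS /W.
  case: leqP => [_|lt_kl]; last by rewrite rising_oppn_eq0 // mul0r !mulr0.
  rewrite (_ : 1 + a - c + (1 + a - e) - 1 - a = 1 + a - c - e); last by ring.
  by field; rewrite !rising_neq0 // fact_neq0.
rewrite exchange_big mulr_sumr; apply: eq_bigr => -[l /= le_ln] _.
rewrite -mulr_sumr (well_poised_5F4_shift F a b d (1 + a - b) (1 + a - d)) // /W.
by field; rewrite !rising_neq0 // fact_neq0.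
Qed.

(** * First-order expansions of rational functions at 0 *)

(* [z] is congruent to [f0 + f1 X] modulo [X^2] in the local ring of [F(X)] at 0. *)
Definition jet (F : fieldType) (z : {fraction {poly F}}) (f0 f1 : F) : Prop :=
  exists p q : {poly F}, q.[0] != 0 /\
    z * tofrac q = tofrac ((f0%:P + f1%:P * 'X) * q + 'X^2 * p).
Arguments jet {F}.

Lemma jet_poly (F : fieldType) (f0 f1 : F) : jet (tofrac (f0%:P + f1%:P * 'X)) f0 f1.
Proof.
by exists 0, 1; rewrite hornerC oner_neq0 mulr0 addr0 mulr1 rmorph1 mulr1.
Qed.

Lemma jet_nat (F : fieldType) n : jet (n%:R : {fraction {poly F}}) n%:R 0.
Proof.
have := jet_poly F n%:R 0.
by rewrite mul0r addr0 polyC_natr rmorph_nat.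
Qed.

Lemma jet_eq (F : fieldType) (z : {fraction {poly F}}) f0 f1 g0 g1 :
  jet z f0 f1 -> f0 = g0 -> f1 = g1 -> jet z g0 g1.
Proof. by move=> ? <- <-. Qed.

Lemma jetD (F : fieldType) (z y : {fraction {poly F}}) f0 f1 g0 g1 :
  jet z f0 f1 -> jet y g0 g1 -> jet (z + y) (f0 + g0) (f1 + g1).
Proof.
move=> [p [q [q0 zq]]] [r [s [s0 ys]]]; exists (p * s + r * q), (q * s); split.
  by rewrite hornerM mulf_neq0.
have -> : (z + y) * tofrac (q * s) = z * tofrac q * tofrac s + y * tofrac s * tofrac q.
  by rewrite rmorphM /=; ring.
by rewrite zq ys -!rmorphM -rmorphD !polyCD; congr tofrac; ring.
Qed.

Lemma jetM (F : fieldType) (z y : {fraction {poly F}}) f0 f1 g0 g1 :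
  jet z f0 f1 -> jet y g0 g1 -> jet (z * y) (f0 * g0) (f0 * g1 + f1 * g0).
Proof.
move=> [p [q [q0 zq]]] [r [s [s0 ys]]].
exists ((f0%:P + f1%:P * 'X) * q * r + p * (g0%:P + g1%:P * 'X) * s + 'X^2 * p * r
        + (f1 * g1)%:P * q * s), (q * s); split.
  by rewrite hornerM mulf_neq0.
have -> : (z * y) * tofrac (q * s) = z * tofrac q * (y * tofrac s).
  by rewrite rmorphM /=; ring.
by rewrite zq ys -!rmorphM; congr tofrac; rewrite !polyCD !polyCM; ring.
Qed.

Lemma jetN (F : fieldType) (z : {fraction {poly F}}) f0 f1 :
  jet z f0 f1 -> jet (- z) (- f0) (- f1).
Proof.
move=> [p [q [q0 zq]]]; exists (- p), q; split=> //.
by rewrite mulNr zq -rmorphN !polyCN; congr tofrac; ring.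
Qed.

(** By subtraction it suffices to treat zero: evaluation at 0 kills the constant term, and division
    by X followed by a second evaluation kills the slope. *)
Lemma jet_inj (F : fieldType) (z : {fraction {poly F}}) f0 f1 g0 g1 :
  jet z f0 f1 -> jet z g0 g1 -> f0 = g0 /\ f1 = g1.
Proof.
suff jet0 h0 h1 : jet (0 : {fraction {poly F}}) h0 h1 -> h0 = 0 /\ h1 = 0.
  move=> zf /jetN /(jetD _ _ _ _ _ _ _ zf); rewrite subrr => /jet0[].
  by move=> /eqP + /eqP; rewrite !subr_eq0 => /eqP-> /eqP->.
move=> [p [q [q0 /esym/eqP]]]; rewrite mul0r tofrac_eq0 => /eqP eq.
have c0 : h0 = 0.
  move: (congr1 (horner^~ 0) eq); rewrite !hornerE /= expr2 !mul0r addr0 => /eqP.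
  by rewrite mulf_eq0 (negPf q0) orbF => /eqP.
move: eq; rewrite c0 add0r.
have -> : h1%:P * 'X * q + 'X^2 * p = (h1%:P * q + 'X * p) * 'X by ring.
move=> /eqP; rewrite mulf_eq0 polyX_eq0 orbF => /eqP eq.
move: (congr1 (horner^~ 0) eq); rewrite !hornerE => /eqP.
by rewrite ?mul0r ?addr0 mulf_eq0 (negPf q0) orbF => /eqP.
Qed.

(** This supplies the non-vanishing hypotheses over rational functions: an element such as -n+X+i
    may vanish at X = 0, yet its slope keeps it nonzero. *)
Lemma jet_neq0 (F : fieldType) (z : {fraction {poly F}}) f0 f1 :
  jet z f0 f1 -> (f0 != 0) || (f1 != 0) -> z != 0.
Proof.
move=> zf; apply: contraL => /eqP z0; rewrite z0 in zf.
by have [-> ->] := jet_inj _ _ _ _ _ _ zf (jet_nat F 0); rewrite eqxx.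
Qed.

Lemma jetV (F : fieldType) (z : {fraction {poly F}}) f0 f1 :
  jet z f0 f1 -> f0 != 0 -> jet z^-1 f0^-1 (- f1 / f0 ^+ 2).
Proof.
move=> zf f0_neq0; have z0 : z != 0 by apply: jet_neq0 zf _; rewrite f0_neq0.
case: zf => p [q [q0 zq]].
(* The new denominator is the old numerator. The remainder comes from (f0 + f1 X)(1/f0 - (f1/f0^2)
   X) = 1 - (f1/f0)^2 X^2. *)
exists ((f1 / f0)%:P ^+ 2 * q - p * (f0^-1%:P + (- f1 / f0 ^+ 2)%:P * 'X)),
  ((f0%:P + f1%:P * 'X) * q + 'X^2 * p); split.
  by rewrite !hornerE /= expr2 !mul0r !addr0 mulf_neq0.
rewrite -zq mulKf //; congr tofrac.
have e : f0%:P * f0^-1%:P = 1 :> {poly F} by rewrite -polyCM mulfV.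
rewrite (_ : - f1 / f0 ^+ 2 = - (f1 / f0 * f0^-1)); last by field.
rewrite polyCN !polyCM.
move: e; move: f0%:P f0^-1%:P f1%:P => A B C e; ring: e.
Qed.

Lemma jet_sum (F : fieldType) n (z : 'I_n -> {fraction {poly F}}) f0 f1 :
  (forall i, jet (z i) (f0 i) (f1 i)) ->
  jet (\sum_i z i) (\sum_i f0 i) (\sum_i f1 i).
Proof.
move=> zf; apply: (big_rec3 (fun y g0 g1 => jet y g0 g1)).
  exact: (jet_nat F 0).
by move=> i *; apply: jetD.
Qed.

(** * Logarithmic derivatives of rising factorials *)

(* [l] is the logarithmic derivative of [z] at 0. *)
Definition log_jet (F : fieldType) (z : {fraction {poly F}}) (w l : F) : Prop :=
  jet z w (w * l).
Arguments log_jet {F}.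

Lemma log_jetM (F : fieldType) (z y : {fraction {poly F}}) w l v m :
  log_jet z w l -> log_jet y v m -> log_jet (z * y) (w * v) (l + m).
Proof. by move=> zj yj; apply: jet_eq (jetM _ _ _ _ _ _ _ zj yj) _ _; rewrite // ; ring. Qed.

Lemma log_jetV (F : fieldType) (z : {fraction {poly F}}) w l :
  log_jet z w l -> w != 0 -> log_jet z^-1 w^-1 (- l).
Proof. by move=> zj w0; apply: jet_eq (jetV _ _ _ _ zj w0) _ _; rewrite //; field. Qed.

(** The factor z+i contributes c1/(c+i). Non-vanishing is asked only for i < k, which admits c = -n
    as long as k <= n. *)
Lemma log_jet_rising (F : fieldType) (z : {fraction {poly F}}) c c1 k :
  jet z c c1 -> (forall i, (i < k)%N -> c + i%:R != 0) ->
  log_jet (rising z k) (rising c k) (c1 * \sum_(i < k) (c + i%:R)^-1).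
Proof.
move=> zj; elim: k => [|k IH] nz.
  by rewrite !rising0 big_ord0 mulr0 /log_jet mulr0; apply: (jet_nat F 1).
rewrite !risingS big_ord_recr /= [c1 * _]mulrDr; apply: log_jetM.
  by apply: IH => i lt_ik; apply: nz; rewrite ltnS ltnW.
apply: jet_eq (jetD _ _ _ _ _ _ _ zj (jet_nat F k)) _ _ => //.
by rewrite addr0; field; apply: nz.
Qed.

Lemma log_jet_eq (F : fieldType) (z : {fraction {poly F}}) w l v m :
  log_jet z w l -> w = v -> l = m -> log_jet z v m.
Proof. by move=> ? <- <-. Qed.

(** * Integer parameters: binomial coefficients and harmonic numbers *)

Lemma rising_succ_nat m k : rising (1 + m%:R : rat) k = binq (m + k) k * (k`!)%:R.
Proof.
rewrite /binq -natrM bin_ffact; elim: k => [|k IH]; first by rewrite rising0.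
by rewrite risingS IH addnS ffactSS natrM nat1r -natrD addSn mulrC.
Qed.

Lemma rising_opp_nat m k : rising (- m%:R : rat) k = (-1) ^+ k * binq m k * (k`!)%:R.
Proof.
rewrite -mulrA /binq -natrM bin_ffact; elim: k => [|k IH]; first by rewrite rising0 mulr1.
rewrite risingS IH ffactnSr; case: (leqP k m) => [le_km|lt_mk].
  by rewrite natrM natrB // exprS; ring.
by rewrite ffact_small // mul0n !mulr0 mul0r.
Qed.

Lemma succ_nat_add_neq0 m i : 1 + m%:R + i%:R != 0 :> rat.
Proof. by rewrite nat1r -natrD pnatr_eq0. Qed.

Lemma opp_nat_add_neq0 m i : (i < m)%N -> - m%:R + i%:R != 0 :> rat.
Proof. by move=> lt_im; rewrite addrC subr_eq0 eqr_nat ltn_eqF. Qed.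

Lemma harmonic_numberS m : harmonic_number m.+1 = harmonic_number m + m.+1%:R^-1.
Proof. by rewrite /harmonic_number big_nat_recr. Qed.

Lemma sum_inv_succ_nat m k :
  \sum_(i < k) (1 + m%:R + i%:R)^-1 = harmonic_number (m + k) - harmonic_number m.
Proof.
elim: k => [|k IH]; first by rewrite big_ord0 addn0 subrr.
by rewrite big_ord_recr /= IH addnS harmonic_numberS nat1r -natrD addSn; ring.
Qed.

Lemma sum_inv_opp_nat n k : (k <= n)%N ->
  \sum_(i < k) (- n%:R + i%:R)^-1 = harmonic_number (n - k) - harmonic_number n.
Proof.
elim: k => [|k IH] lt_kn; first by rewrite big_ord0 subn0 subrr.
rewrite big_ord_recr /= IH; last exact: ltnW.
rewrite -(subnSK lt_kn) harmonic_numberS subnSK // natrB; last exact: ltnW.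
by rewrite (_ : - n%:R + k%:R = - (n%:R - k%:R)) ?invrN; ring.
Qed.

Lemma binq_neq0 m k : (k <= m)%N -> binq m k != 0.
Proof. by move=> le_km; rewrite pnatr_eq0 -lt0n bin_gt0. Qed.

(** * Expansion of the left-hand side of Whipple's transformation *)

(** The value at X = 0 of the 7F6 term stripped of its factor a+2k. *)
Definition well_poised_weight (n b c d e k : nat) : rat :=
  binq n k ^+ 2
     * ((binq (n + b * n) k * binq (n + c * n) k
         * binq (n + d * n) k * binq (n + e * n) k)
        / (binq (k + b * n) k * binq (k + c * n) k
           * binq (k + d * n) k * binq (k + e * n) k)).

(** The parameter [a], moved off -n because Whipple's transformation excludes a+i = 0. *)
Definition opp_nat_addX (n : nat) : {fraction {poly rat}} := - n%:R + tofrac 'X.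

Lemma jet_opp_nat_addX n : jet (opp_nat_addX n) (- n%:R) 1.
Proof.
have := jet_poly rat (- n%:R) 1.
by rewrite mul1r polyCN polyC_natr rmorphD rmorphN rmorph_nat.
Qed.

Lemma jet_opp_nat n : jet (- n%:R : {fraction {poly rat}}) (- n%:R) 0.
Proof. by apply: jet_eq (jetN _ _ _ _ (jet_nat rat n)) _ _; rewrite ?oppr0. Qed.

(** With m = bn this is the lower parameter 1+a-b'. *)
Lemma jet_1_sub_opp_nat n m :
  jet (1 + opp_nat_addX n - (- (n + m)%:R)) (1 + m%:R) 1.
Proof.
apply: jet_eq (jetD _ _ _ _ _ _ _ (jetD _ _ _ _ _ _ _ (jet_nat rat 1)
  (jet_opp_nat_addX n)) (jetN _ _ _ _ (jet_opp_nat (n + m)))) _ _.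
  by rewrite natrD; ring.
by ring.
Qed.

(** The constant term is kept as [1 + 0%:R] to match the pattern [1 + m%:R] of
    [log_jet_rising_succ_nat] at m = 0. *)
Lemma jet_1_add_nat n : jet (1 + opp_nat_addX n + n%:R) (1 + 0%:R) 1.
Proof.
apply: jet_eq (jetD _ _ _ _ _ _ _ (jetD _ _ _ _ _ _ _ (jet_nat rat 1)
  (jet_opp_nat_addX n)) (jet_nat rat n)) _ _; ring.
Qed.

Lemma log_jet_rising_opp_nat n k m : (k <= n)%N ->
  log_jet (rising (- (n + m)%:R : {fraction {poly rat}}) k) (rising (- (n + m)%:R) k) 0.
Proof.
move=> le_kn; apply: log_jet_eq (log_jet_rising _ _ _ _ k (jet_opp_nat (n + m)) _) _ _ => //.
  by move=> i lt_ik; apply: opp_nat_add_neq0; rewrite ltn_addr // (leq_trans lt_ik).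
by rewrite mul0r.
Qed.

Lemma log_jet_rising_succ_nat z m k : jet z (1 + m%:R) 1 ->
  log_jet (rising z k) (rising (1 + m%:R) k) (harmonic_number (m + k) - harmonic_number m).
Proof.
move=> zj; apply: log_jet_eq (log_jet_rising _ _ _ _ k zj _) _ _ => //.
  by move=> i _; apply: succ_nat_add_neq0.
by rewrite mul1r sum_inv_succ_nat.
Qed.

Lemma log_jet_nat n : log_jet (n%:R : {fraction {poly rat}}) n%:R 0.
Proof. by apply: jet_eq (jet_nat rat n) _ _; rewrite ?mulr0. Qed.

Lemma log_jet_weight n b c d e k (a := opp_nat_addX n) : (k <= n)%N ->
  log_jet
    (rising a k * rising (- (n + b * n)%:R) k * rising (- (n + c * n)%:R) k
       * rising (- (n + d * n)%:R) k * rising (- (n + e * n)%:R) k * rising (- n%:R) k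
      / ((k`!)%:R * rising (1 + a - - (n + b * n)%:R) k * rising (1 + a - - (n + c * n)%:R) k
         * rising (1 + a - - (n + d * n)%:R) k
         * rising (1 + a - - (n + e * n)%:R) k * rising (1 + a + n%:R) k))
    (well_poised_weight n b c d e k)
    (harmonic_number (n - k) - harmonic_number n - harmonic_number k
     - (harmonic_number (b * n + k) - harmonic_number (b * n))
     - (harmonic_number (c * n + k) - harmonic_number (c * n))
     - (harmonic_number (d * n + k) - harmonic_number (d * n))
     - (harmonic_number (e * n + k) - harmonic_number (e * n))).
Proof.
move=> le_kn.
have neg p := log_jet_rising_opp_nat n k (p * n) le_kn.
have pos p := log_jet_rising_succ_nat _ _ k (jet_1_sub_opp_nat n (p * n)).
have nz m : rising (1 + m%:R : rat) k != 0 by apply: rising_neq0; apply: succ_nat_add_neq0.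
have nzf : (k`!)%:R != 0 :> rat by rewrite pnatr_eq0 -lt0n fact_gt0.
have ja : log_jet (rising a k) (rising (- n%:R) k) (harmonic_number (n - k) - harmonic_number n).
  apply: log_jet_eq (log_jet_rising _ _ _ _ k (jet_opp_nat_addX n) _) _ _ => //.
    by move=> i lt_ik; apply: opp_nat_add_neq0; rewrite (leq_trans lt_ik).
  by rewrite mul1r sum_inv_opp_nat.
have jn := log_jet_rising_opp_nat n k 0 le_kn; rewrite addn0 in jn.
apply: log_jet_eq.
  apply: log_jetM.
    apply: log_jetM jn; do 4!(apply: log_jetM; last exact: neg); exact: ja.
  apply: log_jetV.
    apply: log_jetM (log_jet_rising_succ_nat _ _ k (jet_1_add_nat n)).
    do 4!(apply: log_jetM; last exact: pos); exact: log_jet_nat.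
  by rewrite !mulf_neq0.
  (* Six upper parameters are negated naturals at X = 0, so their signs (-1)^k cancel, which the
     parity split makes visible to [field]. The six factorials above cancel those below, (1)_k being
     one of them. *)
  rewrite !rising_opp_nat !rising_succ_nat add0n -!(addnC k) /well_poised_weight.
  have nzb m : binq (k + m) k != 0 by rewrite binq_neq0 ?leq_addr.
  rewrite [binq k k]/binq binn -signr_odd.
  by case: (odd k) => /=; field; rewrite !nzb nzf.
rewrite add0n (_ : harmonic_number 0 = 0); first by ring.
by rewrite /harmonic_number big_geq.
Qed.

(** * The symmetry k -> n-k *)

(** The ratio equals (n+m)! m! / ((n-k+m)! (k+m)!), where the reversal only swaps the two lower
    factorials. *)
Lemma binq_ratio_rev n m k : (k <= n)%N ->
  binq (n + m) (n - k) / binq (n - k + m) (n - k) = binq (n + m) k / binq (k + m) k.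
Proof.
have nzf i : (i`!)%:R != 0 :> rat by rewrite pnatr_eq0 -lt0n fact_gt0.
have binqE N i : (i <= N)%N -> binq N i = (N`!)%:R / ((i`!)%:R * ((N - i)`!)%:R).
  move=> le_iN; rewrite -(bin_fact le_iN) !natrM -/(binq N i) mulfK //.
  by rewrite mulf_neq0.
move=> le_kn; rewrite !binqE ?leq_addr //; last first.
- by rewrite (leq_trans (leq_subr _ _)) ?leq_addr.
- by rewrite (leq_trans le_kn) ?leq_addr.
rewrite !addKn (_ : n + m - (n - k) = k + m)%N; last by rewrite -addnBAC ?leq_subr ?subKn.
rewrite addnBAC //.
by field; rewrite !nzf.
Qed.

Lemma weight_rev n b c d e k : (k <= n)%N ->
  well_poised_weight n b c d e (n - k) = well_poised_weight n b c d e k.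
Proof.
have weightE i : well_poised_weight n b c d e i = binq n i ^+ 2 *
    (binq (n + b * n) i / binq (i + b * n) i * (binq (n + c * n) i / binq (i + c * n) i)
     * (binq (n + d * n) i / binq (i + d * n) i) * (binq (n + e * n) i / binq (i + e * n) i)).
  by rewrite /well_poised_weight; field; rewrite !binq_neq0 ?leq_addr.
by move=> le_kn; rewrite !weightE !binq_ratio_rev // [binq n (n - k)]/binq bin_sub.
Qed.

Lemma sum_antisym n (w g : nat -> rat) :
  (forall k, (k <= n)%N -> w (n - k)%N = w k) ->
  \sum_(k < n.+1) w k * (n%:R - 2 * k%:R) * g k
  = - \sum_(k < n.+1) w k * (n%:R - 2 * k%:R) * g (n - k)%N.
Proof.
move=> w_rev; rewrite (reindex_inj rev_ord_inj) -sumrN; apply: eq_bigr => -[k /= le_kn] _.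
rewrite subSS w_rev // natrB //; ring.
Qed.

(** The right-hand side has the shape of the coefficient of X in the 7F6 sum. The two sides differ
    by the sum of w_k (n-2k)(H_k + H_{n-k} + c), which is zero by antisymmetry; for the constant
    part, S = -S gives S = 0. *)
Lemma harmonic_sum_rev n (w h : nat -> rat) c :
  (forall k, (k <= n)%N -> w (n - k)%N = w k) ->
  \sum_(k < n.+1) w k * (1 + (n%:R - 2 * k%:R) * (2 * harmonic_number k + h k))
  = \sum_(k < n.+1) (w k
      + (2 * k%:R - n%:R) * (w k * (harmonic_number (n - k) - harmonic_number k - h k + c))).
Proof.
move=> w_rev.
have := sum_antisym n w (fun=> c) w_rev => /eqP.
rewrite -addr_eq0 -mulr2n mulrn_eq0 => /eqP antic.
have /eqP := sum_antisym n w harmonic_number w_rev.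
rewrite -addr_eq0 => /eqP antiH.
rewrite -[RHS]addr0 -[X in _ = _ + X]addr0 [X in _ = _ + (X + _)](esym antiH) [X in _ = _ + (_ + X)](esym antic).
by rewrite -!big_split; apply: eq_bigr => k _ /=; ring.
Qed.

(** * Expansion of the right-hand side of Whipple's transformation *)

(** Since (a)_{n+1} contains the factor a+n = X, the constant term is zero and the slope is the
    value at X = 0 of all the other factors. *)
Lemma jet_rhs n b c d e (a := opp_nat_addX n) :
  jet (rising a n.+1 * rising (1 + a - - (n + b * n)%:R - - (n + d * n)%:R) n
    / (rising (1 + a - - (n + b * n)%:R) n * rising (1 + a - - (n + d * n)%:R) n)
    * \sum_(l < n.+1) rising (- n%:R) l * rising (- (n + b * n)%:R) l * rising (- (n + d * n)%:R) l
        * rising (1 + a - - (n + c * n)%:R - - (n + e * n)%:R) l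
        / ((l`!)%:R * rising (1 + a - - (n + c * n)%:R) l * rising (1 + a - - (n + e * n)%:R) l
           * rising (- (n + b * n)%:R + - (n + d * n)%:R - n%:R - a) l))
   0 ((-1) ^+ n
    * (binq (2 * n + b * n + d * n) n
       / (binq (n + b * n) n * binq (n + d * n) n))
    * \sum_(l < n.+1)
         binq n l
         * ((binq (n + b * n) l * binq (n + d * n) l
             * binq (n + c * n + e * n + l) l)
            / (binq (l + c * n) l * binq (l + e * n) l
               * binq (2 * n + b * n + d * n) l))).
Proof.
have nz m k : rising (1 + m%:R : rat) k != 0 by apply: rising_neq0; apply: succ_nat_add_neq0.
have nzf k : (k`!)%:R != 0 :> rat by rewrite pnatr_eq0 -lt0n fact_gt0.
have nzb k m : binq (k + m) k != 0 by rewrite binq_neq0 ?leq_addr.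
have pos p k := log_jet_rising_succ_nat _ _ k (jet_1_sub_opp_nat n (p * n)).
have pos2 p q k : log_jet (rising (1 + a - - (n + p * n)%:R - - (n + q * n)%:R) k)
    (rising (1 + (n + p * n + q * n)%:R) k)
    (harmonic_number (n + p * n + q * n + k) - harmonic_number (n + p * n + q * n)).
  apply: log_jet_rising_succ_nat.
  apply: jet_eq (jetD _ _ _ _ _ _ _ (jet_1_sub_opp_nat n (p * n))
    (jetN _ _ _ _ (jet_opp_nat (n + q * n)))) _ _; rewrite ?natrD; ring.
(* Only values at X = 0 will matter here, so the derivatives stay existential. *)
have js l : (l <= n)%N -> exists l1, log_jet (rising (- n%:R) l * rising (- (n + b * n)%:R) l
        * rising (- (n + d * n)%:R) l
        * rising (1 + a - - (n + c * n)%:R - - (n + e * n)%:R) l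
        / ((l`!)%:R * rising (1 + a - - (n + c * n)%:R) l * rising (1 + a - - (n + e * n)%:R) l
           * rising (- (n + b * n)%:R + - (n + d * n)%:R - n%:R - a) l))
     (binq n l
         * ((binq (n + b * n) l * binq (n + d * n) l
             * binq (n + c * n + e * n + l) l)
            / (binq (l + c * n) l * binq (l + e * n) l
               * binq (2 * n + b * n + d * n) l))) l1.
  move=> le_ln; eexists.
  have neg p := log_jet_rising_opp_nat n l (p * n) le_ln.
  have jn := log_jet_rising_opp_nat n l 0 le_ln; rewrite addn0 in jn.
  have le_l2n : (l <= 2 * n + b * n + d * n)%N.
    by rewrite (leq_trans le_ln) // -addnA mul2n -addnn -addnA leq_addr.
  have nzN i : (i < l)%N -> - (2 * n + b * n + d * n)%:R + i%:R != 0 :> rat.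
    by move=> lt_il; apply: opp_nat_add_neq0; rewrite (leq_trans lt_il).
  have jw : jet (- (n + b * n)%:R + - (n + d * n)%:R - n%:R - a)
                (- (2 * n + b * n + d * n)%:R) (-1).
    apply: jet_eq (jetD _ _ _ _ _ _ _ (jetD _ _ _ _ _ _ _ (jetD _ _ _ _ _ _ _
      (jet_opp_nat _) (jet_opp_nat _)) (jet_opp_nat _)) (jetN _ _ _ _ (jet_opp_nat_addX n))) _ _.
      rewrite !natrD !natrM; ring.
    ring.
  apply: log_jet_eq (erefl _).
    apply: log_jetM.
      apply: log_jetM (pos2 c e l); apply: log_jetM (neg d); apply: log_jetM (neg b); exact: jn.
    apply: log_jetV.
      apply: log_jetM (log_jet_rising _ _ _ _ l jw nzN).
      do 2!(apply: log_jetM; last exact: pos); exact: log_jet_nat.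
    by rewrite !mulf_neq0 //; apply/prodf_neq0 => i _; apply: nzN.
  rewrite !rising_opp_nat !rising_succ_nat -!(addnC l).
  (* Three signs (-1)^l come from the upper parameters and one from the lower parameter -(2n+bn+dn);
     they cancel. *)
  rewrite -signr_odd; have := binq_neq0 _ _ le_l2n.
  by case: (odd l) => /= nzw; field; rewrite !nzb nzf nzw.
have [s1 jsum] : exists s1, jet (\sum_(l < n.+1) rising (- n%:R) l * rising (- (n + b * n)%:R) l
        * rising (- (n + d * n)%:R) l
        * rising (1 + a - - (n + c * n)%:R - - (n + e * n)%:R) l
        / ((l`!)%:R * rising (1 + a - - (n + c * n)%:R) l * rising (1 + a - - (n + e * n)%:R) l
           * rising (- (n + b * n)%:R + - (n + d * n)%:R - n%:R - a) l))
     (\sum_(l < n.+1) binq n l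
         * ((binq (n + b * n) l * binq (n + d * n) l
             * binq (n + c * n + e * n + l) l)
            / (binq (l + c * n) l * binq (l + e * n) l
               * binq (2 * n + b * n + d * n) l))) s1.
  apply: (big_ind2 (fun y g => exists g1, jet y g g1)).
  - by exists 0; apply: (jet_nat rat 0).
  - by move=> y1 g1 y2 g2 [? j1] [? j2]; eexists; apply: jetD j1 j2.
  - by move=> [l lt_ln] _; have [? jl] := js l lt_ln; eexists; apply: jl.
have jX : jet (a + n%:R) 0 1.
  by apply: jet_eq (jetD _ _ _ _ _ _ _ (jet_opp_nat_addX n) (jet_nat rat n)) _ _; ring.
have ja : log_jet (rising a n) (rising (- n%:R) n) _ :=
  log_jet_rising _ _ _ _ n (jet_opp_nat_addX n) (fun i => opp_nat_add_neq0 n i).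
have jden := log_jetV _ _ _ _ (log_jetM _ _ _ _ _ _ _ (pos b n) (pos d n))
  (mulf_neq0 (nz _ n) (nz _ n)).
rewrite risingS.
apply: jet_eq (jetM _ _ _ _ _ _ _ (jetM _ _ _ _ _ _ _ (jetM _ _ _ _ _ _ _
  (jetM _ _ _ _ _ _ _ ja jX) (pos2 b d n)) jden) jsum) _ _.
  by rewrite mulr0 !mul0r.
rewrite !(mulr0, mul0r, add0r, mulr1); congr (_ * _).
(* The sign of the theorem is that of (-n)_n = (-1)^n n!, and (1+n+bn+dn)_n yields the binomial
   coefficient in front. *)
rewrite rising_opp_nat !rising_succ_nat [binq n n]/binq binn -!(addnC n).
rewrite (_ : n + (n + b * n + d * n) = 2 * n + b * n + d * n)%N; last by rewrite mul2n -addnn !addnA.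
by field; rewrite !nzb nzf.
Qed.

(** * Comparison of the coefficients of X *)

Theorem theorem12 (n b c d e : nat) :
  \sum_(0 <= k < n.+1)
     binq n k ^+ 2
     * ((binq (n + b * n) k * binq (n + c * n) k
         * binq (n + d * n) k * binq (n + e * n) k)
        / (binq (k + b * n) k * binq (k + c * n) k
           * binq (k + d * n) k * binq (k + e * n) k))
     * (1 + (n%:R - 2 * k%:R)
            * (2 * harmonic_number k
               + harmonic_number (b * n + k) + harmonic_number (c * n + k)
               + harmonic_number (d * n + k) + harmonic_number (e * n + k)))
  = (-1) ^+ n
    * (binq (2 * n + b * n + d * n) n
       / (binq (n + b * n) n * binq (n + d * n) n))
    * \sum_(0 <= l < n.+1)
         binq n l
         * ((binq (n + b * n) l * binq (n + d * n) l
             * binq (n + c * n + e * n + l) l)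
            / (binq (l + c * n) l * binq (l + e * n) l
               * binq (2 * n + b * n + d * n) l)).
Proof.
rewrite !big_mkord.
(* Each parameter that must avoid the nonpositive integers has slope 1 or -1 in X, so it avoids them
   as a rational function. *)
have nz_jet (z : {fraction {poly rat}}) f0 f1 : jet z f0 f1 -> f1 != 0 -> forall i : nat, z + i%:R != 0.
  move=> zj nzf1 i; apply: jet_neq0 (jetD _ _ _ _ _ _ _ zj (jet_nat rat i)) _.
  by rewrite addr0 nzf1 orbT.
have char0 m : m.+1%:R != 0 :> {fraction {poly rat}}.
  by apply: jet_neq0 (jet_nat rat _) _; rewrite pnatr_eq0.
have nzu p := nz_jet _ _ _ (jet_1_sub_opp_nat n (p * n)) (oner_neq0 _).
have jw := jetD _ _ _ _ _ _ _ (jetD _ _ _ _ _ _ _ (jetD _ _ _ _ _ _ _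
      (jet_opp_nat (n + b * n)) (jet_opp_nat (n + d * n))) (jet_opp_nat n))
      (jetN _ _ _ _ (jet_opp_nat_addX n)).
have nzw : 0 + 0 + 0 - 1 != 0 :> rat by [].
have whipple := whipple_7F6_4F3 _ (opp_nat_addX n) _ _ _ _ n char0
  (nz_jet _ _ _ (jet_opp_nat_addX n) (oner_neq0 _)) (nzu b) (nzu c) (nzu d) (nzu e)
  (nz_jet _ _ _ jw nzw).
have jr := jet_rhs n b c d e; cbv zeta in jr; rewrite -whipple in jr.
have jl (k : 'I_n.+1) := jetM _ _ _ _ _ _ _
  (jetD _ _ _ _ _ _ _ (jet_opp_nat_addX n) (jetM _ _ _ _ _ _ _ (jet_nat rat 2) (jet_nat rat k)))
  (log_jet_weight n b c d e k (ltn_ord k)).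
have jsum := jet_sum _ _ _ _ _ jl.
(* Both expansions now describe the same 7F6 sum, so their slopes agree. *)
have [_ <-] := jet_inj _ _ _ _ _ _ jsum jr.
pose h k := harmonic_number (b * n + k) + harmonic_number (c * n + k)
  + harmonic_number (d * n + k) + harmonic_number (e * n + k).
(* [C] collects the terms of the logarithmic derivative that do not depend on k. *)
pose C := harmonic_number (b * n) + harmonic_number (c * n)
  + harmonic_number (d * n) + harmonic_number (e * n) - harmonic_number n.
transitivity (\sum_(k < n.+1) well_poised_weight n b c d e k
  * (1 + (n%:R - 2 * k%:R) * (2 * harmonic_number k + h k))).
  by apply: eq_bigr => k _; rewrite /h !addrA.
rewrite (harmonic_sum_rev n _ h C (weight_rev n b c d e)).
by apply: eq_bigr => k _; rewrite /h /C; ring.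
Qed.
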